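(* Let $\langle\mathcal{M},\mathbb{A},\in\rangle\models ZFA$ and let $S\in\mathcal{M}$ be a set of supports. Let $\mathcal{A},\mathcal{A}'\in\mathcal M$ be first-order structures on $\mathbb{A}$, with $\mathcal{A}$ having pure language, and put $$\mathcal{N}:=PM(\mathcal{M},Aut(\mathcal{A}),\mathcal{F}^{Aut(\mathcal{A})}_S),\qquad \mathcal{N}':=PM(\mathcal{M},Aut(\mathcal{A}'),\mathcal{F}^{Aut(\mathcal{A}')}_S).$$ If $\mathcal{A}\in\mathcal{N}'$, then $\mathcal{N}\subseteq\mathcal{N}'$.
   Context: $ZFA$ is set theory with atoms in the language $\{\in,\mathbb{A}\}$ ($\mathbb{A}$ a unary predicate): the axioms of $ZF$ with extensionality restricted to non-atoms (''sets''), plus: atoms have no elements, and the atoms form a set, also denoted $\mathbb{A}$. All notions below are taken inside $\mathcal{M}$. Every $\pi\in Sym(\mathbb{A})$ (bijections of $\mathbb{A}$) extends to the universe by $\pi(x)=\{\pi(y):y\in x\}$ for sets $x$. For $G\leqslant Sym(\mathbb{A})$, $G_x=\{\pi\in G:\pi(x)=x\}$. $TC(x)$ is the transitive closure of $x$. A normal filter $\mathcal F$ of subgroups of $G$ is a nonempty set of subgroups of $G$, closed under supergroups within $G$, finite intersections and conjugation by elements of $G$, with $G_a\in\mathcal F$ for all $a\in\mathbb{A}$. An element $x$ is symmetric w.r.t. $\mathcal{F}$ if $G_x\in\mathcal F$, and hereditarily symmetric if every $y\in TC(\{x\})$ is symmetric. $PM(\mathcal{M},G,\mathcal{F})$ is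 the class of all hereditarily symmetric $x\in\mathcal M$. For a set $S$ and $G\leqslant Sym(\mathbb{A})$, $\mathcal{F}^G_S$ is the set of subgroups of $G$ that contain a finite intersection of groups of the form $G_x$, $x\in S$ (defined when this is a normal filter of subgroups of $G$). $S$ is a set of supports if $\mathcal{F}^G_S$ is a normal filter for every $G\leqslant Sym(\mathbb{A})$. A set is pure if neither it nor any element of its transitive closure is an atom. A structure is regarded as a function from its language (set of symbols) to its predicates; it has pure language if its language is a pure set. *)

(* Defs.v *)
Set Implicit Arguments.
Unset Strict Implicit.

(** * Models of ZFA *)

Record AtomStr := {
  carrier :> Type;
  mem : carrier -> carrier -> Prop;
  atom : carrier -> Prop }.

Arguments mem {_} _ _.
Arguments atom {_} _.

Declare Scope zfa_scope.
Open Scope zfa_scope.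
Notation "x ∈ y" := (mem x y) (at level 70, no associativity) : zfa_scope.

(** First-order formulas in the language {∈, 𝔸} with equality; variables are
    de Bruijn indices.  They are needed for the two axiom schemes. *)
Inductive formula : Type :=
| FEq (i j : nat)
| FMem (i j : nat)
| FAtom (i : nat)
| FNot (φ : formula)
| FAnd (φ ψ : formula)
| FEx (φ : formula).

Definition scons (T : Type) (x : T) (e : nat -> T) (n : nat) : T :=
  match n with O => x | S m => e m end.

Fixpoint sat (M : AtomStr) (e : nat -> M) (φ : formula) : Prop :=
  match φ with
  | FEq i j => e i = e j
  | FMem i j => e i ∈ e j
  | FAtom i => atom (e i)
  | FNot φ => ~ sat e φ
  | FAnd φ ψ => sat e φ /\ sat e ψ
  | FEx φ => exists x : M, sat (scons x e) φ
  end.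

Section Notions.
Context {M : AtomStr}.
Implicit Types (x y z p q r f n t s d G H F : M).

Definition is_set x : Prop := ~ atom x.

(** [is_setof z P]: z is the set {w | P w}. *)
Definition is_setof z (P : M -> Prop) : Prop :=
  is_set z /\ forall w, w ∈ z <-> P w.

Definition elt d : M -> Prop := fun x => x ∈ d.

Definition subset x y : Prop := forall w, w ∈ x -> w ∈ y.

Definition is_empty z : Prop := is_setof z (fun _ => False).
Definition is_upair z x y : Prop := is_setof z (fun w => w = x \/ w = y).
Definition is_sing z x : Prop := is_setof z (fun w => w = x).
Definition is_succ s n : Prop := is_setof s (fun w => w ∈ n \/ w = n).

Definition is_inductive x : Prop :=
  is_set x /\
  (exists z, is_empty z /\ z ∈ x) /\
  (forall n, n ∈ x -> exists s, is_succ s n /\ s ∈ x).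

End Notions.

Record ZFA (M : AtomStr) : Prop := {
  zfa_atoms_empty : forall a x : M, atom a -> ~ x ∈ a;
  zfa_atoms_set : exists s : M, is_setof s atom;
  zfa_extensionality : forall x y : M, is_set x -> is_set y ->
    (forall w, w ∈ x <-> w ∈ y) -> x = y;
  zfa_pairing : forall x y : M, exists z, is_upair z x y;
  zfa_union : forall x : M, exists u,
    is_setof u (fun w => exists y, y ∈ x /\ w ∈ y);
  zfa_powerset : forall x : M, exists u,
    is_setof u (fun z => is_set z /\ subset z x);
  zfa_infinity : exists x : M, is_inductive x;
  zfa_foundation : forall x : M, (exists y, y ∈ x) ->
    exists y, y ∈ x /\ forall z, z ∈ x -> ~ z ∈ y;
  zfa_separation : forall (φ : formula) (e : nat -> M) (x : M),
    exists u, is_setof u (fun z => z ∈ x /\ sat (scons z e) φ);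
  zfa_replacement : forall (φ : formula) (e : nat -> M) (d : M),
    (forall x y y', x ∈ d -> sat (scons y (scons x e)) φ ->
       sat (scons y' (scons x e)) φ -> y = y') ->
    exists u, is_setof u
      (fun y => exists x, x ∈ d /\ sat (scons y (scons x e)) φ) }.

(** * Notions internal to a model

    Every function, group, natural number, finite set, ... below is an element
    of the model, and quantifiers range over the model.  In particular
    "finite" is finiteness in the sense of the model. *)

Section Internal.
Context {M : AtomStr}.
Implicit Types (x y z a b c p q r f n t s d e G H K F X R L A : M)
  (D C : M -> Prop).

(** ** Functions, natural numbers, finiteness *)

(** Kuratowski pair: z = (x, y) = {{x}, {x, y}}. *)
Definition is_opair z x y : Prop :=
  exists s t, is_sing s x /\ is_upair t x y /\ is_upair z s t.

(** f(x) = y *)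
Definition app f x y : Prop := exists z, is_opair z x y /\ z ∈ f.

(** f is a function from the class D to the class C. *)
Definition is_fun f D C : Prop :=
  is_set f /\
  (forall z, z ∈ f -> exists x y, D x /\ C y /\ is_opair z x y) /\
  (forall x, D x -> exists! y, app f x y).

Definition is_bij f D C : Prop :=
  is_fun f D C /\
  (forall x x' y, app f x y -> app f x' y -> x = x') /\
  (forall y, C y -> exists x, app f x y).

(** n belongs to ω, the least inductive set. *)
Definition is_nat n : Prop := forall x, is_inductive x -> n ∈ x.

Definition is_finite e : Prop :=
  is_set e /\ exists n f, is_nat n /\ is_bij f (elt n) (elt e).

(** ** Transitive closure, purity *)

Definition is_transitive t : Prop := forall y z, y ∈ t -> z ∈ y -> z ∈ t.

Definition is_TC t x : Prop :=
  is_set t /\ is_transitive t /\ subset x t /\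
  forall u, is_set u -> is_transitive u -> subset x u -> subset t u.

Definition is_pure x : Prop :=
  is_set x /\ exists t, is_TC t x /\ forall y, y ∈ t -> is_set y.

(** ** Permutations of the atoms and their action on the universe *)

Definition is_perm p : Prop := is_bij p atom atom.

Definition is_id r : Prop :=
  is_setof r (fun z => exists a, atom a /\ is_opair z a a).

(** r = q ∘ p *)
Definition is_comp r q p : Prop :=
  is_setof r (fun z => exists a b c, is_opair z a c /\ app p a b /\ app q b c).

Definition is_inv r p : Prop :=
  is_setof r (fun z => exists a b, is_opair z b a /\ app p a b).

(** f is the restriction to t of the extension of p to the universe: it agrees
    with p on atoms and f(z) = {f(w) | w ∈ z} for sets z. *)
Definition is_action_on p t f : Prop :=
  is_fun f (elt t) (fun _ => True) /\
  forall z v, app f z v ->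
    (atom z -> app p z v) /\
    (is_set z -> is_setof v (fun u => exists w, w ∈ z /\ app f w u)).

(** p(x) = y for the extension of p to the universe, obtained by
    ∈-recursion: some set-sized approximation on a transitive set sends x
    to y. *)
Definition act p x y : Prop :=
  exists t f, is_set t /\ is_transitive t /\ x ∈ t /\
    is_action_on p t f /\ app f x y.

(** ** Groups of permutations and normal filters *)

(** G ≤ Sym(𝔸) *)
Definition is_group G : Prop :=
  is_set G /\
  (forall p, p ∈ G -> is_perm p) /\
  (exists r, is_id r /\ r ∈ G) /\
  (forall p q, p ∈ G -> q ∈ G -> exists r, is_comp r q p /\ r ∈ G) /\
  (forall p, p ∈ G -> exists r, is_inv r p /\ r ∈ G).

Definition is_subgroup H G : Prop := is_group H /\ subset H G.

(** K = G_x *)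
Definition is_stab K G x : Prop :=
  is_setof K (fun p => p ∈ G /\ act p x x).

(** K = q H q⁻¹ *)
Definition is_conj K q H : Prop :=
  is_setof K (fun r => exists p q' s,
    p ∈ H /\ is_inv q' q /\ is_comp s p q' /\ is_comp r q s).

Definition normal_filter F G : Prop :=
  is_set F /\
  (exists H, H ∈ F) /\
  (forall H, H ∈ F -> is_subgroup H G) /\
  (forall H K, H ∈ F -> is_subgroup K G -> subset H K -> K ∈ F) /\
  (forall X, is_finite X -> (exists H, H ∈ X) -> subset X F ->
     exists K, is_setof K (fun p => forall H, H ∈ X -> p ∈ H) /\ K ∈ F) /\
  (forall H q, H ∈ F -> q ∈ G -> exists K, is_conj K q H /\ K ∈ F) /\
  (forall a, atom a -> exists K, is_stab K G a /\ K ∈ F).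

(** x is symmetric with respect to F *)
Definition symmetric F G x : Prop := exists K, is_stab K G x /\ K ∈ F.

Definition hereditarily_symmetric F G x : Prop :=
  exists s t, is_sing s x /\ is_TC t s /\ forall y, y ∈ t -> symmetric F G y.

(** The class PM(M, G, F). *)
Definition PM G F : M -> Prop := hereditarily_symmetric F G.

(** F = F^G_X, as a set of groups.  The set e indexes the finite intersection
    ⋂_{x ∈ e} G_x, which is G when e is empty. *)
Definition is_filter_of F G X : Prop :=
  is_setof F (fun H => is_subgroup H G /\
    exists e, is_finite e /\ subset e X /\
      forall p, p ∈ G -> (forall x, x ∈ e -> act p x x) -> p ∈ H).

Definition set_of_supports X : Prop :=
  is_set X /\
  forall G, is_group G -> exists F, is_filter_of F G X /\ normal_filter F G.

(** ** First-order structures on the atoms *)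

(** t is an n-tuple of atoms, i.e. a function from the ordinal
    n = {0, ..., n-1} to 𝔸. *)
Definition is_tuple t n : Prop := is_nat n /\ is_fun t (elt n) atom.

Definition is_predicate R : Prop :=
  is_set R /\ exists n, is_nat n /\ forall t, t ∈ R -> is_tuple t n.

(** A is a structure on 𝔸 with language L: a function sending every symbol
    of L to a predicate. *)
Definition is_structure A L : Prop :=
  is_set L /\ is_fun A (elt L) is_predicate.

(** G = Aut(A); the tuple p(t₀), ..., p(tₙ₋₁) is p ∘ t. *)
Definition is_Aut G A : Prop :=
  is_setof G (fun p => is_perm p /\
    forall s R, app A s R ->
    forall n t u, is_tuple t n -> is_comp u p t -> (t ∈ R <-> u ∈ R)).

End Internal.

(* Main.v *)
(** A permutation fixing [A] fixes each symbol of its pure language, hence each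
    predicate of [A], hence is an automorphism of [A]: so [G'_A ≤ G].  If
    [e ⊆ S] supports [y] for [G], then [G'_y] contains [G'_A ∩ ⋂_{x ∈ e} G'_x],
    which lies in the filter [F'] when [A] is symmetric for [F']. *)

Require Import Defs.
From Stdlib Require Import Classical.

(** * Definability of predicates by first-order formulas *)

Section Definability.
Context {M : AtomStr}.
Implicit Types P Q : (nat -> M) -> Prop.

(** A predicate on whole environments, so that parameters enter as further entries of [e]. It links
    predicates of the metatheory to the formulas of the separation scheme. *)
Definition definable P : Prop := exists φ, forall e, sat e φ <-> P e.

Lemma definable_ext P Q : (forall e, P e <-> Q e) -> definable P -> definable Q.
Proof.
intros PQ [φ Hφ]; exists φ; intros e.
rewrite Hφ; apply PQ.
Qed.

Lemma definable_eq i j : definable (fun e => e i = e j).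
Proof. exists (FEq i j); reflexivity. Qed.

Lemma definable_mem i j : definable (fun e => e i ∈ e j).
Proof. exists (FMem i j); reflexivity. Qed.

Lemma definable_atom i : definable (fun e => atom (e i)).
Proof. exists (FAtom i); reflexivity. Qed.

Lemma definable_not P : definable P -> definable (fun e => ~ P e).
Proof. intros [φ Hφ]; exists (FNot φ); intros e; cbn; rewrite Hφ; reflexivity. Qed.

Lemma definable_and P Q :
  definable P -> definable Q -> definable (fun e => P e /\ Q e).
Proof.
intros [φ Hφ] [ψ Hψ]; exists (FAnd φ ψ); intros e; cbn.
rewrite Hφ, Hψ; reflexivity.
Qed.

(** The primitives of [formula] are negation, conjunction and existence; the remaining connectives
    and the universal quantifier are reached by classical equivalences. *)
Lemma definable_imp P Q :
  definable P -> definable Q -> definable (fun e => P e -> Q e).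
Proof.
intros DP DQ.
apply (definable_ext (fun e => ~ (P e /\ ~ Q e))); [intros e; tauto|].
auto using definable_not, definable_and.
Qed.

Lemma definable_or P Q :
  definable P -> definable Q -> definable (fun e => P e \/ Q e).
Proof.
intros DP DQ.
apply (definable_ext (fun e => ~ P e -> Q e)); [intros e; tauto|].
auto using definable_not, definable_imp.
Qed.

Lemma definable_iff P Q :
  definable P -> definable Q -> definable (fun e => P e <-> Q e).
Proof. intros DP DQ; apply definable_and; apply definable_imp; assumption. Qed.

(* The shape of the premise lets [apply] reindex the de Bruijn variables by
   higher-order unification, so that formulas are never written by hand. *)
Lemma definable_ex (Q : M -> (nat -> M) -> Prop) :
  definable (fun e => Q (e 0) (fun n => e (S n))) ->
  definable (fun e => exists x, Q x e).
Proof.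
intros [φ Hφ]; exists (FEx φ); intros e; cbn.
split; intros [x Hx]; exists x; apply (Hφ (scons x e)); exact Hx.
Qed.

Lemma definable_all (Q : M -> (nat -> M) -> Prop) :
  definable (fun e => Q (e 0) (fun n => e (S n))) ->
  definable (fun e => forall x, Q x e).
Proof.
intros DQ.
apply (definable_ext (fun e => ~ exists x, ~ Q x e)).
  intros e; split; [intros H x; apply NNPP; eauto|intros H [x Hx]; auto].
apply definable_not, definable_ex, definable_not, DQ.
Qed.

Lemma definable_True : definable (fun _ => True).
Proof. apply (definable_ext (fun e => e 0 = e 0)); [tauto|apply definable_eq]. Qed.

Lemma definable_False : definable (fun _ => False).
Proof.
apply (definable_ext (fun _ => ~ True)); [tauto|].
apply definable_not, definable_True.
Qed.

End Definability.

(** Unfolds the set-theoretic abbreviations down to membership, equality and [atom], then recurses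
    on the logical structure; [exists!] is handled by unfolding [unique]. *)
Ltac definability :=
  cbv beta delta [act is_action_on is_fun is_transitive is_opair app is_sing
    is_upair is_setof is_set elt unique];
  repeat (cbv beta; first
    [ apply definable_mem | apply definable_eq | apply definable_atom
    | apply definable_True | apply definable_False
    | apply definable_not | apply definable_iff | apply definable_and
    | apply definable_or | apply definable_ex | apply definable_all
    | apply definable_imp ]).

(** * Separation, ordered pairs and relations in ZFA *)

Section ZFATheory.
Context {M : AtomStr} (HM : ZFA M).
Implicit Types (x y z p q r f n t s G H K B C : M).

Lemma separation (Q : M -> M -> M -> Prop) :
  definable (fun e => Q (e 0) (e 1) (e 2)) ->
  forall a b x, exists u, is_setof u (fun z => z ∈ x /\ Q z a b).
Proof.
intros [φ Hφ] a b x.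
(* Variables 0, 1, 2 are the element and the two parameters; [a] is the default value of all later
   variables. *)
destruct (zfa_separation HM φ (scons a (scons b (fun _ => a))) x) as [u [Su Hu]].
exists u; split; [exact Su|]; intros w.
rewrite Hu, Hφ; reflexivity.
Qed.

Lemma mem_is_set x y : x ∈ y -> is_set y.
Proof. intros xy ay; exact (zfa_atoms_empty HM ay xy). Qed.

Lemma setof_ext x y (P Q : M -> Prop) :
  is_setof x P -> is_setof y Q -> (forall w, P w <-> Q w) -> x = y.
Proof.
intros [Sx Hx] [Sy Hy] PQ.
apply (zfa_extensionality HM Sx Sy); intros w.
rewrite Hx, Hy; apply PQ.
Qed.

Lemma setof_unique x y (P : M -> Prop) : is_setof x P -> is_setof y P -> x = y.
Proof. intros Hx Hy; apply (setof_ext _ _ _ _ Hx Hy); reflexivity. Qed.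

Lemma upair_inj z x y x' y' :
  is_upair z x y -> is_upair z x' y' -> (x = x' /\ y = y') \/ (x = y' /\ y = x').
Proof.
intros [_ H] [_ H'].
assert (E : forall w, (w = x \/ w = y) <-> (w = x' \/ w = y')).
  intros w; rewrite <- H, <- H'; reflexivity.
pose proof (proj1 (E x)); pose proof (proj1 (E y)).
pose proof (proj2 (E x')); pose proof (proj2 (E y')).
intuition congruence.
Qed.

Lemma sing_upair s x : is_sing s x <-> is_upair s x x.
Proof.
split; intros [Ss Hs]; split; auto; intros w; rewrite Hs; tauto.
Qed.

Lemma opair_exists x y : exists z, is_opair z x y.
Proof.
destruct (zfa_pairing HM x x) as [s Hs].
destruct (zfa_pairing HM x y) as [t Ht].
destruct (zfa_pairing HM s t) as [z Hz].
exists z, s, t; rewrite sing_upair; auto.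
Qed.

Lemma opair_unique z z' x y : is_opair z x y -> is_opair z' x y -> z = z'.
Proof.
intros (s & t & Hs & Ht & Hz) (s' & t' & Hs' & Ht' & Hz').
rewrite (setof_unique _ _ _ Hs' Hs), (setof_unique _ _ _ Ht' Ht) in Hz'.
exact (setof_unique _ _ _ Hz Hz').
Qed.

Lemma opair_inj z x y x' y' :
  is_opair z x y -> is_opair z x' y' -> x = x' /\ y = y'.
Proof.
intros (s & t & Hs & Ht & Hz) (s' & t' & Hs' & Ht' & Hz').
apply sing_upair in Hs, Hs'.
destruct (upair_inj _ _ _ _ _ Hz Hz') as [[-> ->]|[-> ->]].
  destruct (upair_inj _ _ _ _ _ Hs Hs') as [[-> _]|[-> _]];
  destruct (upair_inj _ _ _ _ _ Ht Ht') as [[? ?]|[? ?]];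
  intuition congruence.
(* Crossed case: {x} = {x', y'} and {x, y} = {x'}, so all four components coincide. *)
destruct (upair_inj _ _ _ _ _ Hs Ht') as [[? ?]|[? ?]];
destruct (upair_inj _ _ _ _ _ Ht Hs') as [[? ?]|[? ?]];
intuition congruence.
Qed.

Lemma app_opair f z x y : is_opair z x y -> (app f x y <-> z ∈ f).
Proof.
intros Hz; split; [|exists z; auto].
intros (z' & Hz' & zf); rewrite (opair_unique _ _ _ _ Hz Hz'); exact zf.
Qed.

(** A Kuratowski pair in [f] has {x, y} as an element, so both coordinates lie in the double union
    of [f]. This bounds later separations over domains. *)
Lemma field_exists f : exists u, forall x y, app f x y -> x ∈ u /\ y ∈ u.
Proof.
destruct (zfa_union HM f) as [v [_ Hv]].
destruct (zfa_union HM v) as [d [_ Hd]].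
exists d; intros x y (z & (s & t & [_ Hs] & [_ Ht] & [_ Hz]) & zf).
assert (tv : t ∈ v) by (apply Hv; exists z; rewrite Hz; auto).
split; apply Hd; exists t; rewrite Ht; auto.
Qed.

(** Pairs with coordinates in u ∪ v are elements of the double power set of u ∪ v, from which [Q] is
    then separated. *)
Lemma relation_exists (Q : M -> M -> M -> Prop) a b u v :
  definable (fun e => Q (e 0) (e 1) (e 2)) ->
  (forall z, Q z a b -> exists x y, is_opair z x y /\ x ∈ u /\ y ∈ v) ->
  exists f, is_setof f (fun z => Q z a b).
Proof.
intros DQ QP.
destruct (zfa_pairing HM u v) as [uv [_ Huv]].
destruct (zfa_union HM uv) as [d [_ Hd]].
destruct (zfa_powerset HM d) as [d1 [_ Hd1]].
destruct (zfa_powerset HM d1) as [d2 [_ Hd2]].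
destruct (separation Q DQ a b d2) as [f [Sf Hf]].
exists f; split; auto; intros z; rewrite Hf; split; [tauto|intros Qz; split; auto].
destruct (QP z Qz) as (x & y & (s & t & [Ss Hs] & [St Ht] & [Sz Hz]) & xu & yv).
assert (xd : x ∈ d) by (apply Hd; exists u; rewrite Huv; auto).
assert (yd : y ∈ d) by (apply Hd; exists v; rewrite Huv; auto).
apply Hd2; split; auto; intros w; rewrite Hz, Hd1.
intros [-> | ->]; split; auto; intros w; [rewrite Hs|rewrite Ht].
  intros ->; auto.
intros [-> | ->]; auto.
Qed.

(** * Composition, inverse and identity; permutations of the atoms *)

Lemma comp_exists q p : exists r, is_comp r q p.
Proof.
destruct (field_exists p) as [u Hu], (field_exists q) as [v Hv].
apply (relation_exists (fun z q p =>
  exists a b c, is_opair z a c /\ app p a b /\ app q b c) q p u v).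
  definability.
intros z (a & b & c & ? & ab & bc); exists a, c.
apply Hu in ab; apply Hv in bc; tauto.
Qed.

Lemma inv_exists p : exists r, is_inv r p.
Proof.
destruct (field_exists p) as [u Hu].
apply (relation_exists (fun z p _ =>
  exists a b, is_opair z b a /\ app p a b) p p u u).
  definability.
intros z (a & b & ? & ab); exists b, a.
apply Hu in ab; tauto.
Qed.

Lemma id_exists : exists r : M, is_id r.
Proof.
destruct (zfa_atoms_set HM) as [u [_ Hu]].
apply (relation_exists (fun z _ _ => exists a, atom a /\ is_opair z a a) u u u u).
  definability.
intros z (a & ? & ?); exists a, a; rewrite Hu; auto.
Qed.

Lemma app_comp r q p a c :
  is_comp r q p -> (app r a c <-> exists b, app p a b /\ app q b c).
Proof.
intros [_ Hr]; destruct (opair_exists a c) as [z Hz].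
rewrite (app_opair _ _ _ _ Hz), Hr; split;
  [|intros (b & ? & ?); exists a, b, c; auto].
intros (a' & b & c' & Hz' & ? & ?).
destruct (opair_inj _ _ _ _ _ Hz Hz') as [-> ->]; eauto.
Qed.

Lemma app_inv r p b a : is_inv r p -> (app r b a <-> app p a b).
Proof.
intros [_ Hr]; destruct (opair_exists b a) as [z Hz].
rewrite (app_opair _ _ _ _ Hz), Hr; split;
  [|intros ab; exists a, b; auto].
intros (a' & b' & Hz' & ?).
destruct (opair_inj _ _ _ _ _ Hz Hz') as [-> ->]; auto.
Qed.

Lemma app_id r a b : is_id r -> (app r a b <-> atom a /\ b = a).
Proof.
intros [_ Hr]; destruct (opair_exists a b) as [z Hz].
rewrite (app_opair _ _ _ _ Hz), Hr; split.
  intros (a' & ? & Hz').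
  destruct (opair_inj _ _ _ _ _ Hz Hz') as [-> ->]; auto.
intros [? ->]; eauto.
Qed.

Lemma fun_app_unique f (D E : M -> Prop) x y y' :
  is_fun f D E -> app f x y -> app f x y' -> y = y'.
Proof.
intros (_ & Hf & Hu) xy xy'.
pose proof xy as (z & Hz & zf).
destruct (Hf z zf) as (x0 & y0 & Dx & _ & Hz').
destruct (opair_inj _ _ _ _ _ Hz Hz') as [-> _].
destruct (Hu x0 Dx) as [w [_ Hw]].
rewrite <- (Hw y), <- (Hw y'); auto.
Qed.

Lemma fun_app_dom f (D E : M -> Prop) x y : is_fun f D E -> app f x y -> D x /\ E y.
Proof.
intros (_ & Hf & _) (z & Hz & zf).
destruct (Hf z zf) as (x0 & y0 & ? & ? & Hz').
destruct (opair_inj _ _ _ _ _ Hz Hz') as [-> ->]; auto.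
Qed.

Lemma relation_ext f g :
  is_set f -> is_set g ->
  (forall z, z ∈ f -> exists x y, is_opair z x y) ->
  (forall z, z ∈ g -> exists x y, is_opair z x y) ->
  (forall x y, app f x y <-> app g x y) -> f = g.
Proof.
intros Sf Sg Rf Rg fg.
apply (zfa_extensionality HM Sf Sg); intros z; split; intros Hz.
  destruct (Rf z Hz) as (x & y & Hxy).
  apply (app_opair _ _ _ _ Hxy), fg, (app_opair _ _ _ _ Hxy), Hz.
destruct (Rg z Hz) as (x & y & Hxy).
apply (app_opair _ _ _ _ Hxy), fg, (app_opair _ _ _ _ Hxy), Hz.
Qed.

Lemma fun_relation f (D E : M -> Prop) z :
  is_fun f D E -> z ∈ f -> exists x y, is_opair z x y.
Proof. intros (_ & Hf & _) zf; destruct (Hf z zf) as (x & y & ? & ? & ?); eauto. Qed.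

Lemma comp_relation r q p z : is_comp r q p -> z ∈ r -> exists x y, is_opair z x y.
Proof. intros [_ Hr] zr; apply Hr in zr; destruct zr as (a & b & c & ? & _); eauto. Qed.

Lemma comp_fun r q p (D E E' : M -> Prop) :
  is_comp r q p -> is_fun p D E -> is_fun q E E' -> is_fun r D E'.
Proof.
intros Hr Hp Hq; split; [apply Hr|split].
  intros z zr; apply Hr in zr; destruct zr as (a & b & c & Hz & ab & bc).
  exists a, c; split; [apply (fun_app_dom _ _ _ _ _ Hp ab)|].
  split; [apply (fun_app_dom _ _ _ _ _ Hq bc)|exact Hz].
intros x Dx.
destruct (proj2 (proj2 Hp) x Dx) as [y [xy _]].
assert (Ey : E y) by apply (fun_app_dom _ _ _ _ _ Hp xy).
destruct (proj2 (proj2 Hq) y Ey) as [w [yw _]].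
exists w; split; [apply (app_comp _ _ _ _ _ Hr); eauto|].
intros w' xw'; apply (app_comp _ _ _ _ _ Hr) in xw'; destruct xw' as (y' & xy' & yw').
rewrite (fun_app_unique _ _ _ _ _ _ Hp xy' xy) in yw'.
exact (fun_app_unique _ _ _ _ _ _ Hq yw yw').
Qed.

Lemma id_perm r : is_id r -> is_perm r.
Proof.
intros Hr; repeat split; [apply Hr| | | |].
- intros z zr; apply Hr in zr; destruct zr as (a & ? & ?); eauto.
- intros x Ax; exists x; split; [apply (app_id _ _ _ Hr); auto|].
  intros y xy; apply (app_id _ _ _ Hr) in xy; symmetry; tauto.
- intros x x' y H H'; apply (app_id _ _ _ Hr) in H, H'; intuition congruence.
- intros y Ay; exists y; apply (app_id _ _ _ Hr); auto.
Qed.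

Lemma comp_perm r q p : is_comp r q p -> is_perm p -> is_perm q -> is_perm r.
Proof.
intros Hr (Fp & Ip & Sp) (Fq & Iq & Sq); split; [|split].
- exact (comp_fun _ _ _ _ _ _ Hr Fp Fq).
- intros x x' y H H'; apply (app_comp _ _ _ _ _ Hr) in H, H'.
  destruct H as (b & ? & ?), H' as (b' & ? & ?).
  assert (b = b') by eauto; subst b'; eauto.
- intros c Ac; destruct (Sq c Ac) as [b bc].
  destruct (Sp b) as [a ab]; [apply (fun_app_dom _ _ _ _ _ Fq bc)|].
  exists a; apply (app_comp _ _ _ _ _ Hr); eauto.
Qed.

Lemma inv_perm r p : is_inv r p -> is_perm p -> is_perm r.
Proof.
intros Hr (Fp & Ip & Sp); repeat split; [apply Hr| | | |].
- intros z zr; apply Hr in zr; destruct zr as (a & b & Hz & ab).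
  exists b, a; destruct (fun_app_dom _ _ _ _ _ Fp ab); auto.
- intros b Ab; destruct (Sp b Ab) as [a ab].
  exists a; split; [apply (app_inv _ _ _ _ Hr), ab|].
  intros a' H; apply (app_inv _ _ _ _ Hr) in H; eauto.
- intros x x' y H H'; apply (app_inv _ _ _ _ Hr) in H, H'.
  exact (fun_app_unique _ _ _ _ _ _ Fp H H').
- intros a Aa; destruct (proj2 (proj2 Fp) a Aa) as [b [ab _]].
  exists b; apply (app_inv _ _ _ _ Hr), ab.
Qed.

Lemma inv_comp_id r r' p : is_perm p -> is_id r -> is_inv r' p -> is_comp r r' p.
Proof.
intros (Fp & Ip & _) Hr Hr'; split; [apply Hr|]; intros z.
rewrite (proj2 Hr); split.
  intros (a & Aa & Hz); destruct (proj2 (proj2 Fp) a Aa) as [b [ab _]].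
  exists a, b, a; rewrite (app_inv _ _ _ _ Hr'); auto.
intros (a & b & c & Hz & ab & bc); apply (app_inv _ _ _ _ Hr') in bc.
rewrite (Ip _ _ _ bc ab) in Hz.
exists a; split; auto; apply (fun_app_dom _ _ _ _ _ Fp ab).
Qed.

(** * The action of a permutation on the universe *)

(** A set-sized approximation to the graph of the extension of [p]. In contrast to [is_action_on],
    functionality is not imposed, and the clause for sets is a back-and-forth condition, which is
    symmetric in the two coordinates. *)
Definition bisimulation p B : Prop := forall z v, app B z v ->
  (atom z -> app p z v) /\
  (is_set z -> is_set v /\
    (forall w, w ∈ z -> exists u, u ∈ v /\ app B w u) /\
    (forall u, u ∈ v -> exists w, w ∈ z /\ app B w u)).

(** Foundation gives an ∈-minimal point where [B] and [C] disagree. There the elements are already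
    moved alike, so extensionality forces equal values; on an atom both values are the one given by
    [p]. The case of equal [B] and [C] says that a bisimulation is functional. *)
Lemma bisimulation_functional p B C x y y' :
  is_perm p -> bisimulation p B -> bisimulation p C ->
  app B x y -> app C x y' -> y = y'.
Proof.
intros [Fp _] HB HC xy xy'.
apply NNPP; intros yy'.
destruct (field_exists B) as [u Hu].
destruct (separation (fun z B C =>
  exists v v', app B z v /\ app C z v' /\ v <> v') ltac:(definability) B C u)
  as [d [_ Hd]].
destruct (zfa_foundation HM (x := d)) as (z & zd & zmin).
  exists x; apply Hd; split; [apply (Hu _ _ xy)|eauto].
apply Hd in zd; destruct zd as (_ & v & v' & zv & zv' & vv').
assert (E : forall w s s', w ∈ z -> app B w s -> app C w s' -> s = s').
  intros w s s' wz ws ws'; apply NNPP; intros ss'.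
  apply (zmin w); auto; apply Hd; split; [apply (Hu _ _ ws)|eauto].
destruct (HB _ _ zv) as [HBa HBs], (HC _ _ zv') as [HCa HCs].
destruct (classic (atom z)) as [Az|Sz].
  apply vv', (fun_app_unique _ _ _ _ _ _ Fp (HBa Az) (HCa Az)).
destruct (HBs Sz) as (Sv & B1 & B2), (HCs Sz) as (Sv' & C1 & C2).
apply vv', (zfa_extensionality HM Sv Sv'); intros w; split; intros Hw.
  destruct (B2 w Hw) as (s & sz & sw), (C1 s sz) as (w' & Hw' & sw').
  rewrite (E _ _ _ sz sw sw'); exact Hw'.
destruct (C2 w Hw) as (s & sz & sw), (B1 s sz) as (w' & Hw' & sw').
rewrite <- (E _ _ _ sz sw' sw); exact Hw'.
Qed.

(** Bisimulations, unlike approximations on a transitive set, are closed under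
    inverses and composition without any adjustment of domains. *)
Lemma act_bisimulation p x y : is_perm p ->
  (act p x y <-> exists B, bisimulation p B /\ app B x y).
Proof.
intros Pp; split.
  intros (t & f & St & Tt & xt & [Ff Hf] & xy); exists f; split; auto.
  intros z v zv; destruct (Hf z v zv) as [Ha Hs].
  split; auto; intros Sz; destruct (Hs Sz) as [Sv Hv]; split; auto; split.
    intros w wz.
    assert (wt : w ∈ t) by (apply (Tt z); auto; apply (fun_app_dom _ _ _ _ _ Ff zv)).
    destruct (proj2 (proj2 Ff) w wt) as [u [wu _]].
    exists u; rewrite Hv; eauto.
  intros u uv; apply Hv, uv.
intros (B & HB & xy).
destruct (field_exists B) as [u Hu].
(* The domain of [B]; the forth condition makes it transitive. *)
destruct (separation (fun z B _ => exists v, app B z v) ltac:(definability) B B u)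
  as [t [St Ht]].
(* [B] may have elements that are not ordered pairs, which [is_fun] forbids; [f] keeps only its
   pairs. *)
destruct (separation (fun z _ _ => exists x y, is_opair z x y)
  ltac:(definability) B B B) as [f [Sf Hf]].
assert (At : forall z v, app B z v -> z ∈ t).
  intros z v zv; apply Ht; split; [apply (Hu _ _ zv)|eauto].
assert (Af : forall z v, app f z v <-> app B z v).
  intros z v; destruct (opair_exists z v) as [w Hw].
  rewrite !(app_opair _ _ _ _ Hw), Hf; split; [tauto|eauto].
exists t, f; split; [exact St|split; [|split; [eauto|split; [split|apply Af, xy]]]].
- intros z w zt wz; apply Ht in zt; destruct zt as (_ & v & zv).
  destruct (HB _ _ zv) as [_ HBs].
  destruct (HBs (mem_is_set _ _ wz)) as (_ & B1 & _).
  destruct (B1 w wz) as (s & _ & ws); eauto.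
- split; auto; split.
    intros w wf; pose proof wf as wf'.
    apply Hf in wf'; destruct wf' as (wB & z & v & Hw).
    exists z, v; split; [apply (At z v)|auto].
    apply (app_opair _ _ _ _ Hw), wB.
  intros z zt; apply Ht in zt; destruct zt as (_ & v & zv).
  exists v; split; [apply Af, zv|]; intros v' zv'; apply Af in zv'.
  exact (bisimulation_functional _ _ _ _ _ _ Pp HB HB zv zv').
- intros z v zv; apply Af in zv; destruct (HB _ _ zv) as [Ha Hs].
  split; auto; intros Sz; destruct (Hs Sz) as (Sv & B1 & B2).
  split; auto; intros w; split.
    intros wv; destruct (B2 w wv) as (s & ? & ?); exists s; rewrite Af; auto.
  intros (s & sz & sw); apply Af in sw.
  destruct (B1 s sz) as (w' & w'v & sw').
  rewrite (bisimulation_functional _ _ _ _ _ _ Pp HB HB sw sw'); exact w'v.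
Qed.

Lemma act_comp r q p x y z : is_perm p -> is_perm q -> is_comp r q p ->
  act p x y -> act q y z -> act r x z.
Proof.
intros Pp Pq Hr xy yz.
apply (act_bisimulation _ _ _ Pp) in xy; destruct xy as (B & HB & xy).
apply (act_bisimulation _ _ _ Pq) in yz; destruct yz as (C & HC & yz).
destruct (comp_exists C B) as [D HD].
apply (act_bisimulation _ _ _ (comp_perm _ _ _ Hr Pp Pq)).
exists D; split; [|apply (app_comp _ _ _ _ _ HD); eauto].
intros a c ac; apply (app_comp _ _ _ _ _ HD) in ac; destruct ac as (b & ab & bc).
destruct (HB _ _ ab) as [Ba Bs], (HC _ _ bc) as [Ca Cs]; split.
  intros Aa; specialize (Ba Aa).
  apply (app_comp _ _ _ _ _ Hr); exists b; split; auto.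
  apply Ca, (fun_app_dom _ _ _ _ _ (proj1 Pp) Ba).
intros Sa; destruct (Bs Sa) as (Sb & B1 & B2), (Cs Sb) as (Sc & C1 & C2).
split; [exact Sc|split].
  intros w wa; destruct (B1 w wa) as (v & vb & wv), (C1 v vb) as (u & uc & vu).
  exists u; split; auto; apply (app_comp _ _ _ _ _ HD); eauto.
intros u uc; destruct (C2 u uc) as (v & vb & vu), (B2 v vb) as (w & wa & wv).
exists w; split; auto; apply (app_comp _ _ _ _ _ HD); eauto.
Qed.

Lemma act_inv r p x y : is_perm p -> is_inv r p -> act p x y -> act r y x.
Proof.
intros Pp Hr xy.
apply (act_bisimulation _ _ _ Pp) in xy; destruct xy as (B & HB & xy).
destruct (inv_exists B) as [D HD].
apply (act_bisimulation _ _ _ (inv_perm _ _ Hr Pp)).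
exists D; split; [|apply (app_inv _ _ _ _ HD), xy].
intros b a ba; apply (app_inv _ _ _ _ HD) in ba.
destruct (HB _ _ ba) as [Ba Bs].
(* The clauses of [B] depend on the kind of [a], those of [D] on the kind of [b]. The two kinds
   agree because [p] sends atoms to atoms and [B] relates sets to sets. *)
destruct (classic (atom a)) as [Aa|Sa].
  specialize (Ba Aa); destruct (fun_app_dom _ _ _ _ _ (proj1 Pp) Ba) as [_ Ab].
  split; [intros _; apply (app_inv _ _ _ _ Hr), Ba|intros Sb; contradiction].
destruct (Bs Sa) as (Sb & B1 & B2).
split; [intros Ab; contradiction|intros _; split; [exact Sa|split]].
  intros w wb; destruct (B2 w wb) as (v & ? & ?).
  exists v; rewrite (app_inv _ _ _ _ HD); auto.
intros w wa; destruct (B1 w wa) as (v & ? & ?).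
exists v; rewrite (app_inv _ _ _ _ HD); auto.
Qed.

Lemma act_atom p x y : is_perm p -> atom x -> act p x y -> app p x y.
Proof.
intros Pp Ax xy; apply (act_bisimulation _ _ _ Pp) in xy; destruct xy as (B & HB & xy).
apply (HB _ _ xy), Ax.
Qed.

Lemma act_set p x y : is_perm p -> is_set x -> act p x y ->
  is_set y /\
  (forall w, w ∈ x -> exists u, u ∈ y /\ act p w u) /\
  (forall u, u ∈ y -> exists w, w ∈ x /\ act p w u).
Proof.
intros Pp Sx xy; apply (act_bisimulation _ _ _ Pp) in xy; destruct xy as (B & HB & xy).
destruct (HB _ _ xy) as [_ H]; destruct (H Sx) as (Sy & H1 & H2).
split; [exact Sy|split].
  intros w wx; destruct (H1 w wx) as (u & ? & ?); exists u; split; auto.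
  apply (act_bisimulation _ _ _ Pp); eauto.
intros u uy; destruct (H2 u uy) as (w & ? & ?); exists w; split; auto.
apply (act_bisimulation _ _ _ Pp); eauto.
Qed.

Lemma act_unique p x y y' : is_perm p -> act p x y -> act p x y' -> y = y'.
Proof.
intros Pp xy xy'.
apply (act_bisimulation _ _ _ Pp) in xy; destruct xy as (B & HB & xy).
apply (act_bisimulation _ _ _ Pp) in xy'; destruct xy' as (C & HC & xy').
exact (bisimulation_functional _ _ _ _ _ _ Pp HB HC xy xy').
Qed.

(** The images of the components are extracted from the given image of the pair, so no appeal is
    made to totality of [act]. *)
Lemma act_upair p z x y z' : is_perm p -> is_upair z x y -> act p z z' ->
  exists x' y', act p x x' /\ act p y y' /\ is_upair z' x' y'.
Proof.
intros Pp [Sz Hz] zz'; destruct (act_set _ _ _ Pp Sz zz') as (Sz' & H1 & H2).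
destruct (H1 x) as (x' & xz' & xx'); [apply Hz; auto|].
destruct (H1 y) as (y' & yz' & yy'); [apply Hz; auto|].
exists x', y'; split; [exact xx'|split; [exact yy'|split; [exact Sz'|]]].
intros w; split; [|intros [-> | ->]; assumption].
intros wz'; destruct (H2 w wz') as (v & vz & vw).
apply Hz in vz; destruct vz as [-> | ->]; [left|right]; eauto using act_unique.
Qed.

Lemma act_opair p z x y z' : is_perm p -> is_opair z x y -> act p z z' ->
  exists x' y', act p x x' /\ act p y y' /\ is_opair z' x' y'.
Proof.
intros Pp (s & t & Hs & Ht & Hz) zz'; apply sing_upair in Hs.
destruct (act_upair _ _ _ _ _ Pp Hz zz') as (s' & t' & ss' & tt' & Hz').
destruct (act_upair _ _ _ _ _ Pp Hs ss') as (x1 & x2 & xx1 & xx2 & Hs').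
destruct (act_upair _ _ _ _ _ Pp Ht tt') as (x' & y' & xx' & yy' & Ht').
rewrite (act_unique _ _ _ _ Pp xx1 xx'), (act_unique _ _ _ _ Pp xx2 xx') in Hs'.
exists x', y'; split; [exact xx'|split; [exact yy'|]].
exists s', t'; rewrite sing_upair; auto.
Qed.

(** An ∈-minimal moved element of [t] would have only fixed elements, hence be fixed by
    extensionality. Applied below to symbols of a pure language and to the indices of tuples. *)
Lemma act_pure p t x y : is_perm p ->
  is_transitive t -> (forall z, z ∈ t -> is_set z) -> x ∈ t -> act p x y -> x = y.
Proof.
intros Pp Tt St xt xy; apply NNPP; intros nxy.
destruct (separation (fun z p _ => exists v, act p z v /\ z <> v)
  ltac:(definability) p p t) as [d [_ Hd]].
destruct (zfa_foundation HM (x := d)) as (z & zd & zmin).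
  exists x; apply Hd; eauto.
apply Hd in zd; destruct zd as (zt & v & zv & nzv).
assert (E : forall w s, w ∈ z -> act p w s -> w = s).
  intros w s wz ws; apply NNPP; intros nws.
  apply (zmin w); auto; apply Hd; split; eauto.
destruct (act_set _ _ _ Pp (St z zt) zv) as (Sv & H1 & H2).
apply nzv, (zfa_extensionality HM (St z zt) Sv); intros w; split; intros Hw.
  destruct (H1 w Hw) as (u & uv & wu); rewrite (E _ _ Hw wu); exact uv.
destruct (H2 w Hw) as (u & uz & uw); rewrite <- (E _ _ uz uw); exact uz.
Qed.

(** * Natural numbers, tuples and automorphism groups *)

Lemma nat_pure n :
  is_nat n -> is_transitive n /\ forall k, k ∈ n -> is_set k.
Proof.
intros Nn; destruct (zfa_infinity HM) as [x (_ & (z & Ez & zx) & Ix)].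
(* Induction: the good members of an inductive set again form an inductive set. The clause
   [is_set n] strengthens the induction hypothesis, because [n] becomes an element of its
   successor. *)
destruct (separation (fun n _ _ =>
  is_set n /\ is_transitive n /\ forall k, k ∈ n -> is_set k)
  ltac:(definability) x x x) as [d [Sd Hd]].
enough (Id : is_inductive d) by (apply (Nn d) in Id; apply Hd in Id; tauto).
split; [exact Sd|split].
  exists z; split; [exact Ez|]; destruct Ez as [Sz Ez]; apply Hd.
  split; [exact zx|split; [exact Sz|split]].
    intros y w yz; apply Ez in yz; contradiction.
  intros k kz; apply Ez in kz; contradiction.
intros m md; apply Hd in md; destruct md as (mx & Sm & Tm & Pm).
destruct (Ix m mx) as (s & [Ss Hs] & sx); exists s; split; [split; assumption|].
apply Hd; split; [exact sx|split; [exact Ss|split]].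
  intros y w; rewrite !Hs; intros [ym| ->] wy; left; eauto.
intros k; rewrite Hs; intros [km| ->]; auto.
Qed.

Lemma inv_sym r p : is_perm p -> is_inv r p -> is_inv p r.
Proof.
intros Pp Hr; split; [apply Pp|]; intros z; split.
  intros zp; destruct (fun_relation _ _ _ _ (proj1 Pp) zp) as (a & b & Hz).
  exists b, a; rewrite (app_inv _ _ _ _ Hr), (app_opair _ _ _ _ Hz); auto.
intros (b & a & Hz & ba); apply (app_inv _ _ _ _ Hr) in ba.
apply (app_opair _ _ _ _ Hz), ba.
Qed.

Lemma comp_assoc r q p t u v :
  is_comp r q p -> is_comp v p t -> is_comp u r t -> is_comp u q v.
Proof.
intros Hr Hv Hu; split; [apply Hu|]; intros z; rewrite (proj2 Hu); split.
  intros (a & b & c & Hz & ab & bc); apply (app_comp _ _ _ _ _ Hr) in bc.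
  destruct bc as (d & bd & dc); exists a, d, c; rewrite (app_comp _ _ _ _ _ Hv); eauto.
intros (a & d & c & Hz & ad & dc); apply (app_comp _ _ _ _ _ Hv) in ad.
destruct ad as (b & ab & bd); exists a, b, c; rewrite (app_comp _ _ _ _ _ Hr); eauto.
Qed.

Lemma comp_inv_cancel r p t u (D : M -> Prop) :
  is_perm p -> is_inv r p -> is_fun t D atom -> is_comp u r t -> is_comp t p u.
Proof.
intros Pp Hr Ft Hu; split; [apply Ft|]; intros z; split.
  intros zt; destruct (fun_relation _ _ _ _ Ft zt) as (a & c & Hz).
  apply (app_opair _ _ _ _ Hz) in zt.
  destruct (proj2 (proj2 Pp) c) as [b bc]; [apply (fun_app_dom _ _ _ _ _ Ft zt)|].
  exists a, b, c; split; [exact Hz|split; [|exact bc]].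
  apply (app_comp _ _ _ _ _ Hu); exists c; rewrite (app_inv _ _ _ _ Hr); auto.
intros (a & b & c & Hz & ab & bc); apply (app_comp _ _ _ _ _ Hu) in ab.
destruct ab as (c' & ac' & c'b); apply (app_inv _ _ _ _ Hr) in c'b.
rewrite (fun_app_unique _ _ _ _ _ _ (proj1 Pp) bc c'b) in Hz.
apply (app_opair _ _ _ _ Hz), ac'.
Qed.

Lemma comp_id r t u (D : M -> Prop) : is_id r -> is_fun t D atom -> is_comp u r t -> u = t.
Proof.
intros Hr Ft Hu; apply relation_ext; [apply Hu|apply Ft| | |].
- intros z; apply (comp_relation _ _ _ _ Hu).
- intros z; apply (fun_relation _ _ _ _ Ft).
- intros a c; rewrite (app_comp _ _ _ _ _ Hu); split.
    intros (b & ab & bc); apply (app_id _ _ _ Hr) in bc; destruct bc as [_ ->]; exact ab.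
  intros ac; exists c; split; auto; apply (app_id _ _ _ Hr); split; auto.
  apply (fun_app_dom _ _ _ _ _ Ft ac).
Qed.

Lemma comp_tuple u p t n : is_perm p -> is_tuple t n -> is_comp u p t -> is_tuple u n.
Proof.
intros Pp [Nn Ft] Hu; split; [exact Nn|].
exact (comp_fun _ _ _ _ _ _ Hu Ft (proj1 Pp)).
Qed.

Lemma Aut_group G A : is_Aut G A -> is_group G.
Proof.
intros [SG HG]; split; [exact SG|split; [|split; [|split]]].
- intros p pG; apply HG, pG.
- destruct id_exists as [r Hr]; exists r; split; auto; apply HG.
  split; [exact (id_perm _ Hr)|]; intros s R _ n t u [_ Ft] Hu.
  rewrite (comp_id _ _ _ _ Hr Ft Hu); reflexivity.
- intros p q pG qG; apply HG in pG, qG; destruct pG as [Pp Hp], qG as [Pq Hq].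
  destruct (comp_exists q p) as [r Hr]; exists r; split; auto; apply HG.
  split; [exact (comp_perm _ _ _ Hr Pp Pq)|]; intros s R sR n t u Ht Hu.
  destruct (comp_exists p t) as [v Hv].
  rewrite (Hp s R sR n t v Ht Hv).
  apply (Hq s R sR n); [exact (comp_tuple _ _ _ _ Pp Ht Hv)|].
  exact (comp_assoc _ _ _ _ _ _ Hr Hv Hu).
- intros p pG; apply HG in pG; destruct pG as [Pp Hp].
  destruct (inv_exists p) as [r Hr]; exists r; split; auto; apply HG.
  pose proof (inv_perm _ _ Hr Pp) as Pr.
  split; [exact Pr|]; intros s R sR n t u Ht Hu; symmetry.
  (* [p] carries [u] back to [t], so invariance under [p] at the tuple [u] is the required
     equivalence. *)
  apply (Hp s R sR n); [exact (comp_tuple _ _ _ _ Pr Ht Hu)|].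
  exact (comp_inv_cancel _ _ _ _ _ Pp Hr (proj2 Ht) Hu).
Qed.

(** Reconciles the elementwise action with the composition used in [is_Aut]: a pair (k, a) of the
    graph goes to (k, p(a)), the index [k] being fixed since it is pure. *)
Lemma act_tuple p t n u t' : is_perm p -> is_tuple t n -> is_comp u p t ->
  act p t t' -> t' = u.
Proof.
intros Pp [Nn Ft] Hu tt'; destruct (nat_pure _ Nn) as [Tn Pn].
destruct (act_set _ _ _ Pp (proj1 Ft) tt') as (St' & H1 & H2).
assert (E : forall w w', w ∈ t -> act p w w' ->
    exists k a b, is_opair w k a /\ is_opair w' k b /\ app p a b).
  intros w w' wt ww'; destruct (fun_relation _ _ _ _ Ft wt) as (k & a & Hw).
  destruct (act_opair _ _ _ _ _ Pp Hw ww') as (k' & b & kk' & ab & Hw').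
  apply (app_opair _ _ _ _ Hw) in wt; destruct (fun_app_dom _ _ _ _ _ Ft wt) as [kn Aa].
  rewrite <- (act_pure _ _ _ _ Pp Tn Pn kn kk') in Hw'.
  exists k, a, b; eauto using act_atom.
apply (zfa_extensionality HM St' (proj1 Hu)); intros z; rewrite (proj2 Hu); split.
  intros zt'; destruct (H2 z zt') as (w & wt & wz).
  destruct (E w z wt wz) as (k & a & b & Hw & Hz & ab).
  exists k, a, b; rewrite (app_opair _ _ _ _ Hw); auto.
intros (k & a & c & Hz & (w & Hw & wt) & ac).
destruct (H1 w wt) as (w' & w't' & ww').
destruct (E w w' wt ww') as (k' & a' & b & Hw1 & Hw' & ab).
destruct (opair_inj _ _ _ _ _ Hw Hw1) as [<- <-].
rewrite (fun_app_unique _ _ _ _ _ _ (proj1 Pp) ac ab) in Hz.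
rewrite (opair_unique _ _ _ _ Hz Hw'); exact w't'.
Qed.

Lemma fixing_structure_Aut G A L p : is_structure A L -> is_pure L -> is_Aut G A ->
  is_perm p -> act p A A -> p ∈ G.
Proof.
intros [_ FA] [_ (d & (_ & Td & Ld & _) & Pd)] [_ HG] Pp pA.
apply HG; split; [exact Pp|]; intros s R sR.
(* The pair (s, R) goes to a pair (s, R') of [A], because the symbol [s] is pure; as [A] is a
   function, R' = R. *)
assert (pR : act p R R).
  destruct sR as (z & Hz & zA).
  destruct (proj1 (proj2 (act_set _ _ _ Pp (proj1 FA) pA)) z zA) as (z' & z'A & zz').
  destruct (act_opair _ _ _ _ _ Pp Hz zz') as (s' & R' & ss' & RR' & Hz').
  apply (app_opair _ _ _ _ Hz) in zA; apply (app_opair _ _ _ _ Hz') in z'A.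
  rewrite <- (act_pure _ _ _ _ Pp Td Pd (Ld s (proj1 (fun_app_dom _ _ _ _ _ FA zA))) ss')
    in z'A.
  rewrite <- (fun_app_unique _ _ _ _ _ _ FA zA z'A) in RR'; exact RR'.
assert (SR : is_set R) by apply (fun_app_dom _ _ _ _ _ FA sR).
(* One implication, for an arbitrary permutation fixing [R]; its instance at the inverse of [p]
   gives the converse. *)
assert (E : forall p n t u, is_perm p -> act p R R -> is_tuple t n -> is_comp u p t ->
    t ∈ R -> u ∈ R).
  clear p Pp pA pR; intros p n t u Pp pR Ht Hu tR.
  destruct (proj1 (proj2 (act_set _ _ _ Pp SR pR)) t tR) as (t' & t'R & tt').
  rewrite <- (act_tuple _ _ _ _ _ Pp Ht Hu tt'); exact t'R.
intros n t u Ht Hu; split; [eauto|].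
destruct (inv_exists p) as [q Hq]; pose proof (inv_perm _ _ Hq Pp) as Pq.
apply (E q n); [exact Pq|exact (act_inv _ _ _ _ Pp Hq pR)| |].
  exact (comp_tuple _ _ _ _ Pp Ht Hu).
exact (comp_inv_cancel _ _ _ _ _ Pq (inv_sym _ _ Pp Hq) (proj2 Ht) Hu).
Qed.

(** * Stabilisers, pointwise fixers and intersections in a filter *)

(** That the identity fixes each [x] would require approximations of the action on transitive sets
    containing [x]. A member [p0] of [K] supplies them: the identity is its inverse composed with
    [p0], and both fix [x]. With [X] a class, the lemma serves single points and supports alike. *)
Lemma fixer_subgroup G K (X : M -> Prop) : is_group G ->
  is_setof K (fun p => p ∈ G /\ forall x, X x -> act p x x) ->
  (exists p, p ∈ K) -> is_subgroup K G.
Proof.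
intros (SG & PG & [i [Hi iG]] & CG & VG) [SK HK] [p0 p0K].
assert (KG : forall p, p ∈ K -> p ∈ G) by (intros p pK; apply HK, pK).
split; [|exact KG]; split; [exact SK|split; [auto|split; [|split]]].
- exists i; split; [exact Hi|]; apply HK; split; [exact iG|]; intros x Xx.
  apply HK in p0K; destruct p0K as [p0G Fp].
  destruct (VG p0 p0G) as (q & Hq & qG).
  pose proof (PG _ p0G) as Pp; pose proof (PG _ qG) as Pq.
  apply (act_comp i q p0 x x x Pp Pq); auto.
    exact (inv_comp_id _ _ _ Pp Hi Hq).
  apply (act_inv _ _ _ _ Pp Hq); auto.
- intros p q pK qK; destruct (CG p q) as (r & Hr & rG); auto.
  exists r; split; [exact Hr|]; apply HK in pK, qK; apply HK; split; [exact rG|].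
  intros x Xx; apply (act_comp r q p x x x); intuition.
- intros p pK; destruct (VG p) as (r & Hr & rG); auto.
  exists r; split; [exact Hr|]; apply HK in pK; apply HK; split; [exact rG|].
  intros x Xx; apply (act_inv r p x x); intuition.
Qed.

Lemma stab_subgroup G K x : is_group G -> is_stab K G x -> (exists p, p ∈ K) ->
  is_subgroup K G.
Proof.
intros GG [SK HK] NK; apply (fixer_subgroup G K (fun y => y = x)); auto.
split; [exact SK|]; intros p; rewrite HK.
split; intros [pG px]; split; auto; intros y ->; exact px.
Qed.

Lemma stab_exists G x : exists K, is_stab K G x.
Proof.
apply (separation (fun p x _ => act p x x) ltac:(definability) x x G).
Qed.

Lemma fixer_exists G s :
  exists K, is_setof K (fun p => p ∈ G /\ forall x, x ∈ s -> act p x x).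
Proof.
apply (separation (fun p s _ => forall x, x ∈ s -> act p x x) ltac:(definability) s s G).
Qed.

Lemma upair_finite z x y : is_upair z x y -> x <> y -> is_finite z.
Proof.
intros [Sz Hz] xy; split; [exact Sz|].
destruct (separation (fun _ _ _ => False) ltac:(definability) x x x) as [zero H0].
assert (E0 : is_empty zero) by (split; [apply H0|intros w; rewrite (proj2 H0); tauto]).
(* The von Neumann numerals 1 = {0} and 2 = {0, 1}. The bijection [f] from 2 sends 0 to [x] and 1 to
   [y]. *)
destruct (zfa_pairing HM zero zero) as [one H1].
destruct (zfa_pairing HM zero one) as [two H2].
assert (n01 : zero <> one).
  intros E; apply (proj2 E0 zero); rewrite E at 2; apply H1; auto.
destruct (opair_exists zero x) as [v Hv], (opair_exists one y) as [w Hw].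
destruct (zfa_pairing HM v w) as [f [Sf Hf]].
assert (Af : forall a b, app f a b <-> (a = zero /\ b = x) \/ (a = one /\ b = y)).
  intros a b; destruct (opair_exists a b) as [u Hu].
  rewrite (app_opair _ _ _ _ Hu), Hf; split.
    intros [-> | ->]; [left|right];
      [exact (opair_inj _ _ _ _ _ Hu Hv)|exact (opair_inj _ _ _ _ _ Hu Hw)].
  intros [[-> ->]|[-> ->]]; [left|right]; eauto using opair_unique.
exists two, f; split.
  (* [two] is a natural number: an inductive set contains [zero], hence its successor [one], hence
     [two]. *)
  intros d (_ & (o & Eo & od) & Id).
  rewrite (setof_unique _ _ _ Eo E0) in od.
  destruct (Id zero od) as (s & Hs & sd).
  rewrite (setof_ext _ _ _ _ Hs H1) in sd.
    destruct (Id one sd) as (s' & Hs' & sd').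
    rewrite (setof_ext _ _ _ _ Hs' H2) in sd'; [exact sd'|].
    intros u; rewrite (proj2 H1); tauto.
  intros u; rewrite (proj2 E0); tauto.
unfold elt; repeat split; [exact Sf| | | |].
- intros u uf; apply Hf in uf; destruct uf as [-> | ->].
    exists zero, x; rewrite (proj2 H2), Hz; auto.
  exists one, y; rewrite (proj2 H2), Hz; auto.
- intros a a2; apply (proj2 H2) in a2; destruct a2 as [-> | ->].
    exists x; split; [apply Af; auto|]; intros b; rewrite Af; intuition congruence.
  exists y; split; [apply Af; auto|]; intros b; rewrite Af; intuition congruence.
- intros a a' b; rewrite !Af; intuition congruence.
- intros b bz; apply Hz in bz; destruct bz as [-> | ->];
    [exists zero|exists one]; apply Af; auto.
Qed.

Lemma normal_filter_inter F G H K : normal_filter F G -> H ∈ F -> K ∈ F ->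
  exists J, J ∈ F /\ forall p, p ∈ J <-> p ∈ H /\ p ∈ K.
Proof.
intros (_ & _ & _ & _ & IF & _) HF KF.
(* The pair {H, K} is matched with the numeral 2, which requires distinct groups. *)
destruct (classic (H = K)) as [<- | HK].
  exists H; split; [exact HF|tauto].
destruct (zfa_pairing HM H K) as [X HX].
destruct (IF X) as (J & [_ HJ] & JF).
- exact (upair_finite _ _ _ HX HK).
- exists H; apply HX; auto.
- intros w wX; apply HX in wX; destruct wX as [-> | ->]; assumption.
- exists J; split; [exact JF|]; intros p; rewrite HJ; split.
    intros E; split; apply E, HX; auto.
  intros [pH pK] w wX; apply HX in wX; destruct wX as [-> | ->]; assumption.
Qed.

End ZFATheory.

Theorem mainTheorem2 (M : AtomStr) (HM : ZFA M)
  (S : M) (HS : set_of_supports S)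
  (A A' L L' : M)
  (HA : is_structure A L) (HL : is_pure L) (HA' : is_structure A' L')
  (G G' F F' : M)
  (HG : is_Aut G A) (HG' : is_Aut G' A')
  (HF : is_filter_of F G S) (HF' : is_filter_of F' G' S)
  (HAN : PM G' F' A) :
  forall x : M, PM G F x -> PM G' F' x.
Proof.
pose proof (Aut_group HM _ _ HG') as GG'.
(* The defining condition determines the filter uniquely, so [F'] is the normal one provided by
   [HS]. *)
assert (NF' : normal_filter F' G').
  destruct (proj2 HS G' GG') as (F1 & HF1 & NF1).
  rewrite (setof_unique HM _ _ _ HF' HF1); exact NF1.
assert (sA : symmetric F' G' A).
  destruct HAN as (s & t & [_ Hs] & (_ & _ & st & _) & Ht).
  apply Ht, st, Hs; reflexivity.
destruct sA as (KA & [_ HKA] & KAF).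
(* The transitive closure of {x} involves neither group nor filter, so only symmetry of its elements
   has to be transferred. *)
intros x (s & t & Hs & Ht & Hsym); exists s, t; split; [exact Hs|split; [exact Ht|]].
intros y yt; destruct (Hsym y yt) as (Ky & [_ HKy] & KyF).
apply (proj2 HF) in KyF; destruct KyF as [[GKy _] (e & fe & eS & He)].
destruct (stab_exists HM G' y) as [K HK]; exists K; split; [exact HK|].
assert (SK : is_subgroup K G').
  apply (stab_subgroup HM _ _ _ GG' HK).
  (* The stabiliser [Ky] is a group, so the identity belongs to it and fixes [y]. The identity of
     [G'] is the same set, which makes [K] nonempty. *)
  destruct GKy as (_ & _ & (i & Hi & iKy) & _); exists i; apply HK.
  destruct GG' as (_ & _ & (i' & Hi' & iG') & _).
  rewrite (setof_unique HM _ _ _ Hi Hi') in *; split; [exact iG'|].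
  apply HKy, iKy.
destruct (fixer_exists HM G' e) as [Ke HKe].
destruct (classic (exists p, p ∈ Ke)) as [NKe|NKe].
- assert (KeF : Ke ∈ F').
    apply (proj2 HF'); split; [exact (fixer_subgroup HM _ _ _ GG' HKe NKe)|].
    exists e; split; [exact fe|split; [exact eS|]].
    intros p pG' pe; apply (proj2 HKe); auto.
  destruct (normal_filter_inter HM _ _ _ _ NF' KeF KAF) as (J & JF & HJ).
  destruct NF' as (_ & _ & _ & Up & _); apply (Up J K JF SK).
  intros p pJ; apply HJ in pJ; destruct pJ as [pKe pKA].
  apply (proj2 HKe) in pKe; apply HKA in pKA; destruct pKe as [pG' pe].
  (* [He] concerns members of [G] only; [p] is one because it fixes [A]. *)
  apply HK; split; [exact pG'|]; apply HKy, He; [|exact pe].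
  apply (fixing_structure_Aut HM _ _ _ _ HA HL HG); [|apply pKA].
  apply GG', pG'.
(* Impossible, since the identity fixes every set; but proving this needs
   transitive closures, while vacuously [e] supports [y]. *)
- apply (proj2 HF'); split; [exact SK|].
  exists e; split; [exact fe|split; [exact eS|]].
  intros p pG' pe; destruct NKe; exists p; apply (proj2 HKe); auto.
Qed.
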